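(* Let $d_{w,1}$ be a Lorentz sequence space (with $p=1$). Let $T\in L(d_{w,1})$ be strictly singular and suppose $T=AB$ where $A\in L(\ell_1,d_{w,1})$ and $B\in L(d_{w,1},\ell_1)$ are both positive operators. Then $T\in\overline{J^j}$.
   Context: Let $w=(w_n)$ be a real sequence with $w_1=1$, $w_n\downarrow 0$ and $\sum_n w_n=\infty$. The Lorentz sequence space $d_{w,1}$ is the Banach space of all $x=(x_n)\in c_0$ with $\|x\|=\sum_{n}w_n x^*_n<\infty$, where $(x^*_n)$ is the non-increasing rearrangement of $(|x_n|)$. Both $\ell_1$ and $d_{w,1}$ are ordered coordinate-wise ($x\ge 0$ iff all coordinates are $\ge 0$); an operator is positive if it maps nonnegative vectors to nonnegative vectors. The formal identity $j\colon\ell_1\to d_{w,1}$ sends the $n$-th unit vector of $\ell_1$ to that of $d_{w,1}$. $J^j$ is the set of $S\in L(d_{w,1})$ of the form $S=CjD$ with $C\in L(d_{w,1})$, $D\in L(d_{w,1},\ell_1)$, and $\overline{J^j}$ its norm closure. An operator is strictly singular if its restriction to no infinite-dimensional closed subspace is an isomorphism. *)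

(* Defs.v *)
From HB Require Import structures.
From mathcomp Require Import all_boot all_order all_algebra.
From mathcomp Require Import all_classical all_reals all_analysis.
Set Implicit Arguments. Unset Strict Implicit. Unset Printing Implicit Defensive.
Import Order.TTheory GRing.Theory Num.Theory.
Import numFieldNormedType.Exports.
Local Open Scope classical_set_scope.
Local Open Scope ring_scope.

Section Defs.
Variable R : realType.

Definition ell1 (x : nat -> R) : Prop := cvgn (series (fun n => `|x n|)).
Definition norm1 (x : nat -> R) : R := limn (series (fun n => `|x n|)).

(* non-increasing rearrangement (0-indexed) of (|x_n|):
   x*_n = inf { s >= 0 : #{k : |x_k| > s} <= n } *)
Definition rearr (x : nat -> R) (n : nat) : R :=
  inf [set s : R | 0 <= s /\
        exists l : seq nat, (size l <= n)%N /\ forall k, s < `|x k| -> k \in l].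

Definition dw (w : nat -> R) (x : nat -> R) : Prop :=
  x @ \oo --> (0 : R) /\ cvgn (series (fun n => w n * rearr x n)).
Definition normd (w : nat -> R) (x : nat -> R) : R :=
  limn (series (fun n => w n * rearr x n)).

(* bounded linear operators from (X, nX) to (Y, nY), given as functions
   on sequences whose behaviour outside X is irrelevant *)
Definition is_op (X : (nat -> R) -> Prop) (nX : (nat -> R) -> R)
  (Y : (nat -> R) -> Prop) (nY : (nat -> R) -> R)
  (T : (nat -> R) -> (nat -> R)) : Prop :=
  (forall x, X x -> Y (T x)) /\
  (forall (a : R) x y, X x -> X y ->
     T (fun k => a * x k + y k) = (fun k => a * T x k + T y k)) /\
  (exists C : R, forall x, X x -> nY (T x) <= C * nX x).

Definition positive_op (X : (nat -> R) -> Prop) (T : (nat -> R) -> (nat -> R)) :=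
  forall x, X x -> (forall n, 0 <= x n) -> forall n, 0 <= T x n.

Definition subspace_d (w : nat -> R) (M : (nat -> R) -> Prop) : Prop :=
  (forall x, M x -> dw w x) /\ M (fun _ => 0) /\
  (forall (a : R) x y, M x -> M y -> M (fun k => a * x k + y k)).

Definition closed_d (w : nat -> R) (M : (nat -> R) -> Prop) : Prop :=
  forall x, dw w x ->
    (forall eps : R, 0 < eps -> exists y, M y /\ normd w (fun k => x k - y k) < eps) ->
    M x.

Definition infinite_dim (M : (nat -> R) -> Prop) : Prop :=
  forall n : nat, exists f : 'I_n -> (nat -> R),
    (forall i, M (f i)) /\
    (forall c : 'I_n -> R,
       (fun k => \sum_(i < n) c i * f i k) = (fun _ => 0) -> forall i, c i = 0).

Definition strictly_singular (w : nat -> R) (T : (nat -> R) -> (nat -> R)) : Prop :=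
  forall M, subspace_d w M -> closed_d w M -> infinite_dim M ->
    ~ (exists c : R, 0 < c /\ forall x, M x -> c * normd w x <= normd w (T x)).

(* formal identity j : l_1 -> d_{w,1} *)
Definition jmap (x : nat -> R) : nat -> R := x.

Definition in_closure_Jj (w : nat -> R) (T : (nat -> R) -> (nat -> R)) : Prop :=
  forall eps : R, 0 < eps ->
    exists C D : (nat -> R) -> (nat -> R),
      is_op (dw w) (normd w) (dw w) (normd w) C /\
      is_op (dw w) (normd w) ell1 norm1 D /\
      forall x, dw w x ->
        normd w (fun k => T x k - C (jmap (D x)) k) <= eps * normd w x.

End Defs.

(* Main.v *)
Require Import Defs.
From HB Require Import structures.
From mathcomp Require Import all_boot all_order all_algebra.
From mathcomp Require Import all_classical all_reals all_analysis.
From mathcomp Require Import ring lra.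
Set Implicit Arguments. Unset Strict Implicit. Unset Printing Implicit Defensive.
Import Order.TTheory GRing.Theory Num.Theory.
Import numFieldNormedType.Exports.
Local Open Scope classical_set_scope.
Local Open Scope ring_scope.

(* Let [col i >= 0] be the columns of [A] and let [A_d] keep only the entries
   of [A] that are at least [d].  A column has bounded norm, so it has at most
   [N(d)] such entries and [A_d] maps l_1 boundedly into l_1; hence [A_d B]
   factors through the formal identity [j], and it suffices to show
   [||(A - A_d) B|| -> 0] as [d -> 0].  By positivity [(A - A_d) B |x|] is
   dominated by [T |x|] and its sup norm is at most [d ||B|| ||x||].  So if the
   convergence fails, there are normalized [x_k >= 0] such that [T x_k]
   dominates vectors of norm at least [c] and sup norm tending to [0].  A gliding
   hump argument, taken relative to a coordinatewise cluster point [z] of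
   [(T x_k)], extracts a subsequence whose images admit a lower l_1-estimate;
   [T] is then bounded below on its closed span and is not strictly singular. *)

(** * Finite lists of indices *)

Lemma seq_argmax {R : realDomainType} (f : nat -> R) (s : seq nat) :
  s != [::] -> exists2 k, k \in s & forall i, i \in s -> f i <= f k.
Proof.
elim: s => // a s IH _; case: (eqVneq s [::]) => [->|/IH[k ks kmax]].
  by exists a; rewrite ?mem_head // => i; rewrite inE => /eqP->.
case: (leP (f k) (f a)) => [ka|/ltW ak].
  exists a; rewrite ?mem_head // => i; rewrite inE => /predU1P[->//|/kmax].
  by move=> /le_trans; apply.
exists k; first by rewrite inE ks orbT.
by move=> i; rewrite inE => /predU1P[->//|/kmax].
Qed.

Lemma seq_bound (l : seq nat) : exists N, forall k, k \in l -> (k < N)%N.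
Proof.
elim: l => [|a l [N lN]]; first by exists 0%N.
exists (maxn a.+1 N) => k; rewrite inE leq_max => /predU1P[->|/lN ->]; last exact: orbT.
by rewrite ltnSn.
Qed.

(** * The non-increasing rearrangement *)

Section Rearrangement.
Variable R : realType.
Implicit Types (x y : nat -> R) (l : seq nat).

Lemma rearr_le x n s l : 0 <= s -> (size l <= n)%N ->
  (forall k, s < `|x k| -> k \in l) -> rearr x n <= s.
Proof.
move=> s0 ln H; apply: ge_inf; first by exists 0 => y [].
by split => //; exists l.
Qed.

(** A list that catches all indices above a level [r < s] must contain [l], hence is too long. The
    bound [b] makes the set in [rearr] nonempty, so that its infimum is genuine. *)
Lemma le_rearr x b n s l : (forall k, `|x k| <= b) -> uniq l -> (n < size l)%N ->
  (forall k, k \in l -> s <= `|x k|) -> s <= rearr x n.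
Proof.
move=> xb ul nl ls; apply: lb_le_inf.
  exists b; split; first exact: le_trans (xb 0%N).
  by exists [::]; split=> // k; rewrite ltNge xb.
move=> r [r0 [l' [l'n l'r]]]; rewrite leNgt; apply/negP => rs.
have /uniq_leq_size : {subset l <= l'}.
  by move=> k /ls sk; apply: l'r; exact: lt_le_trans sk.
by move=> /(_ ul); rewrite leqNgt (leq_ltn_trans l'n nl).
Qed.

Lemma rearr_ge0 x b n : (forall k, `|x k| <= b) -> 0 <= rearr x n.
Proof.
move=> xb; apply: (le_rearr (l := iota 0 n.+1) xb); rewrite ?iota_uniq ?size_iota //.
Qed.

(** Induction on the length, removing an index where [|x|] is smallest on [l]: all entries of [l]
    are at least that value, so [le_rearr] puts it below the last term on the right. *)
Lemma sum_le_rearr x b l : (forall k, `|x k| <= b) -> uniq l ->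
  \sum_(k <- l) `|x k| <= \sum_(i < size l) rearr x i.
Proof.
move=> xb; move sl: (size l) => n; elim: n l sl => [|n IH] l sl ul.
  by rewrite (size0nil sl) big_nil big_ord0.
have [|k kl kmin] := @seq_argmax _ (fun i => - `|x i|) l; first by rewrite -size_eq0 sl.
rewrite (perm_big _ (perm_to_rem kl)) big_cons big_ord_recr /= addrC lerD //.
  by apply: IH; rewrite ?rem_uniq // size_rem // sl.
apply: (le_rearr xb ul); rewrite ?sl // => i /kmin; by rewrite lerN2.
Qed.

(** If [x] vanishes off [l], any index outside [l] will do. Otherwise some [|x k1| > 0] off [l]
    exceeds all entries beyond some [N], and a maximum over the finitely many candidates below [N]
    is global. *)
Lemma greedy_max x l : x @ \oo --> (0 : R) ->
  exists2 k, k \notin l & forall i, `|x k| < `|x i| -> i \in l.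
Proof.
move=> x0; have [k0 lk0] := seq_bound l.
have k0l : k0 \notin l by apply/negP => /lk0; rewrite ltnn.
have [[k1 [k1l xk1]]|H] := pselect (exists k, k \notin l /\ 0 < `|x k|); last first.
  exists k0 => // i xi; apply/negPn/negP => il; apply: H; exists i; split => //.
  exact: le_lt_trans xi.
have [N _ HN] := (cvgr0Pnorm_lt _).1 x0 _ xk1.
have k1N : (k1 < N)%N by rewrite ltnNge; apply/negP => /HN; rewrite /= ltxx.
pose s := [seq k <- iota 0 N | k \notin l].
have k1s : k1 \in s by rewrite mem_filter k1l mem_iota.
have [|k ks kmax] := @seq_argmax _ (fun i => `|x i|) s.
  by apply/eqP => s0; rewrite s0 in k1s.
exists k; first by move: ks; rewrite mem_filter => /andP[].
move=> i; apply: contraPT => il; apply/negP; rewrite -leNgt.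
have [iN|Ni] := ltnP i N; first by apply: kmax; rewrite mem_filter il mem_iota.
apply: le_trans (kmax _ k1s); exact/ltW/HN.
Qed.

End Rearrangement.

(** * The weight sequence *)

Record is_weight (R : realType) (w : nat -> R) : Prop := IsWeight {
  weight0 : w 0%N = 1;
  weight_dec : forall m n : nat, (m <= n)%N -> w n <= w m;
  weight_cvg0 : w @ \oo --> (0 : R);
  weight_sum : series w @ \oo --> +oo }.

Lemma weight_ge0 (R : realType) (w : nat -> R) : is_weight w -> forall n, 0 <= w n.
Proof.
move=> hw n; have cw : cvgn w by apply/cvg_ex; exists 0; exact: weight_cvg0 hw.
have := nonincreasing_cvgn_ge _ cw n; rewrite (cvg_lim _ (weight_cvg0 hw)) //; apply.
by move=> m k mk; apply: (weight_dec hw); exact: mk.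
Qed.

(** * Weighted sums along finite lists *)

Section LSum.
Variables (R : realType) (w : nat -> R).
Implicit Types (x y : nat -> R) (l : seq nat).

(* [normd w x] is the supremum of [lsum 0 l x] over duplicate-free lists [l];
   the offset [m] makes concatenation of lists additive. *)
Fixpoint lsum (m : nat) l x : R :=
  if l is k :: l' then w m * `|x k| + lsum m.+1 l' x else 0.

Lemma lsum_cat m l l' x : lsum m (l ++ l') x = lsum m l x + lsum (m + size l) l' x.
Proof.
elim: l m => [|k l IH] m /=; first by rewrite add0r addn0.
by rewrite IH addrA addnS addSn.
Qed.

Lemma lsum_rcons m l k x : lsum m (rcons l k) x = lsum m l x + w (m + size l) * `|x k|.
Proof. by rewrite -cats1 lsum_cat /= addr0. Qed.

Lemma lsumZ m l a x : lsum m l (fun k => a * x k) = `|a| * lsum m l x.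
Proof.
elim: l m => [|k l IH] m /=; first by rewrite mulr0.
by rewrite IH normrM mulrDr mulrCA.
Qed.

Lemma lsum0 m l : lsum m l (fun _ => 0) = 0.
Proof. by elim: l m => //= k l IH m; rewrite IH normr0 mulr0 addr0. Qed.

Hypothesis hw : is_weight w.
Let w_dec := weight_dec hw.
Let w_ge0 := weight_ge0 hw.

Lemma ler_lsum m l x y : (forall k, k \in l -> `|x k| <= `|y k|) ->
  lsum m l x <= lsum m l y.
Proof.
elim: l m => //= k l IH m H; rewrite lerD ?ler_wpM2l ?H ?mem_head //.
by apply: IH => i il; apply: H; rewrite inE il orbT.
Qed.

Lemma lsumD m l x y : lsum m l (fun k => x k + y k) <= lsum m l x + lsum m l y.
Proof.
elim: l m => [|k l IH] m /=; first by rewrite addr0.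
by rewrite addrACA lerD // -mulrDr ler_wpM2l // ler_normD.
Qed.

Lemma lsum_shift m n l x : (m <= n)%N -> lsum n l x <= lsum m l x.
Proof.
elim: l m n => //= k l IH m n mn; rewrite lerD ?IH //.
by rewrite ler_wpM2r // w_dec.
Qed.

(** Splitting a list moves every entry to an earlier position, where the weight is at least as
    large. *)
Lemma lsum_filter (p : pred nat) m l x :
  lsum m l x <= lsum m [seq k <- l | p k] x + lsum m [seq k <- l | ~~ p k] x.
Proof.
elim: l m => [|k l IH] m /=; first by rewrite addr0.
case: (p k) => /=.
  rewrite -addrA lerD2l; apply: le_trans (IH _) _; rewrite lerD2l; exact: lsum_shift.
rewrite addrCA lerD2l; apply: le_trans (IH _) _; rewrite lerD2r; exact: lsum_shift.
Qed.

Lemma lsum_bounded m l x s : (forall k, k \in l -> `|x k| <= s) ->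
  lsum m l x <= (size l)%:R * s.
Proof.
elim: l m => [|k l IH] m /= H; first by rewrite mul0r.
rewrite mulrS mulrDl mul1r lerD //; last first.
  by apply: IH => i il; apply: H; rewrite inE il orbT.
apply: le_trans (H _ (mem_head _ _)); rewrite ler_piMl // -(weight0 hw); exact: w_dec.
Qed.

Lemma lsum_le_rearr x b l : (forall k, `|x k| <= b) -> uniq l ->
  lsum 0 l x <= \sum_(i < size l) w i * rearr x i.
Proof.
move=> xb ul.
(* Abel summation: the partial sums of [rearr x] dominate those of [`|x k|]. *)
have key : w (size l) * (\sum_(i < size l) rearr x i - \sum_(k <- l) `|x k|) <=
    \sum_(i < size l) w i * rearr x i - lsum 0 l x.
  elim/last_ind: l ul => [|l k IH]; first by rewrite big_nil !big_ord0 /= !subrr mulr0.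
  rewrite rcons_uniq => /andP[kl ul]; have {IH} := IH ul.
  rewrite size_rcons lsum_rcons add0n !big_ord_recr /= big_rcons /=.
  set a := \sum_(i < _) rearr _ _; set c := \sum_(i <- _) _.
  set d := \sum_(i < _) _; set e := lsum _ _ _; move=> IH.
  have := rearr_ge0 (size l) xb.
  have := sum_le_rearr xb ul; rewrite -/a -/c => ca r0.
  have ulk : uniq (rcons l k) by rewrite rcons_uniq kl.
  have := sum_le_rearr xb ulk.
  rewrite size_rcons big_ord_recr /= big_rcons /= -/a -/c => E'.
  have wn : w (size l).+1 <= w (size l) by apply: w_dec.
  have := ler_wpM2r (_ : 0 <= a + rearr x (size l) - (c + `|x k|)) wn.
  rewrite subr_ge0 => /(_ E') E''; apply: le_trans E'' _.
  have wx : w (size l) * (a + rearr x (size l) - (c + `|x k|)) =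
    w (size l) * (a - c) + (w (size l) * rearr x (size l) - w (size l) * `|x k|) by ring.
  rewrite wx; lra.
rewrite -subr_ge0; apply: le_trans key; rewrite mulr_ge0 // subr_ge0.
exact: sum_le_rearr ul.
Qed.

End LSum.

(** * The Lorentz norm as a supremum over lists *)

Section LorentzNorm.
Variables (R : realType) (w : nat -> R).
Hypothesis hw : is_weight w.
Let w_ge0 := weight_ge0 hw.
Implicit Types (x y : nat -> R) (l : seq nat).

Local Hint Resolve w_ge0 : core.

Lemma sum_weight_unbounded K : exists n, K < \sum_(i < n) w i.
Proof.
have /cvgryPgt/(_ K)[n _ Hn] := weight_sum hw; exists n.
by have := Hn n (leqnn n); rewrite /= /series /= big_mkord.
Qed.

Lemma lsum_ge_const s l x : (forall k, k \in l -> s <= `|x k|) ->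
  s * (\sum_(i < size l) w i) <= lsum w 0 l x.
Proof.
elim/last_ind: l => [|l k IH] H; first by rewrite big_ord0 mulr0.
rewrite size_rcons big_ord_recr lsum_rcons mulrDr lerD //.
  by apply: IH => i il; apply: H; rewrite mem_rcons inE il orbT.
by rewrite mulrC ler_wpM2l // H // mem_rcons mem_head.
Qed.

(** If [|x k| >= e] held for arbitrarily large [k], there would be lists of every length [n] with
    weighted sum at least [e] times the [n]-th partial sum of [w], and these are unbounded. *)
Lemma lsum_bounded_cvg0 K x :
  (forall l, uniq l -> lsum w 0 l x <= K) -> x @ \oo --> (0 : R).
Proof.
move=> H; apply/cvgr0Pnorm_lt => e e0; apply: contrapT => Hx.
have [n nK] := sum_weight_unbounded (K / e).
suff [l [ul sl le]] : exists l, [/\ uniq l, size l = n & forall k, k \in l -> e <= `|x k|].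
  have := le_trans (lsum_ge_const le) (H _ ul).
  by rewrite sl mulrC -ler_pdivlMr // leNgt nK.
elim: (n) => [|m [l [ul sl le]]]; first by exists [::].
have [N lN] := seq_bound l.
have [k [Nk ek]] : exists k, (N <= k)%N /\ e <= `|x k|.
  apply: contrapT => Hk; apply: Hx; exists N => // k Nk /=.
  by rewrite ltNge; apply/negP => ek; apply: Hk; exists k.
exists (k :: l); split => /=; rewrite ?sl ?ul ?andbT //.
  by apply/negP => /lN; rewrite ltnNge Nk.
by move=> i; rewrite inE => /predU1P[->//|/le].
Qed.

(** Append the largest remaining coordinate at each step. All larger ones are already in the list of
    length [n], so that list witnesses that [rearr x n] is at most the appended value. *)
Lemma greedy_list n x : x @ \oo --> (0 : R) -> exists l,
  [/\ uniq l, size l = n & \sum_(i < n) w i * rearr x i <= lsum w 0 l x].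
Proof.
move=> x0; elim: n => [|n [l [ul sl H]]]; first by exists [::]; rewrite big_ord0.
have [k kl kmax] := greedy_max l x0.
exists (rcons l k); rewrite rcons_uniq kl ul size_rcons sl; split => //.
rewrite big_ord_recr lsum_rcons /= add0n sl lerD // ler_wpM2l //.
by apply: (rearr_le (l := l)) => //; rewrite sl.
Qed.

Lemma rearr_series_nd x b : (forall k, `|x k| <= b) ->
  nondecreasing_seq (series (fun n => w n * rearr x n)).
Proof.
move=> xb; apply/nondecreasing_seqP => n; rewrite /series /= big_nat_recr //=.
by rewrite lerDl mulr_ge0 // (rearr_ge0 _ xb).
Qed.

Lemma cvg0_bounded x : x @ \oo --> (0 : R) -> exists b, forall k, `|x k| <= b.
Proof.
move=> /cvgr0Pnorm_lt/(_ 1 ltr01)[N _ HN].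
exists (1 + \sum_(i < N) `|x i|) => k; have [kN|Nk] := ltnP k N; last first.
  by apply: le_trans (ltW (HN _ Nk)) _; rewrite lerDl sumr_ge0.
rewrite (bigD1 (Ordinal kN)) //= addrCA lerDl addr_ge0 // sumr_ge0 //.
Qed.

(** Together with [lsum_le_normd], this reduces membership in [dw w] and norm inequalities to
    estimates on finite lists, where the rearrangement no longer appears. *)
Lemma lsum_bounded_dw K x : (forall l, uniq l -> lsum w 0 l x <= K) ->
  dw w x /\ normd w x <= K.
Proof.
move=> H; have x0 := lsum_bounded_cvg0 H; have [b xb] := cvg0_bounded x0.
have sK n : series (fun n => w n * rearr x n) n <= K.
  rewrite /series /= big_mkord; have [l [ul _ Hl]] := greedy_list n x0.
  exact: le_trans Hl (H _ ul).
have cx : cvgn (series (fun n => w n * rearr x n)).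
  apply: nondecreasing_is_cvgn; first exact: rearr_series_nd xb.
  by exists K => _ [n _ <-].
split; first by split.
by apply: limr_le => //; apply: nearW.
Qed.

Lemma lsum_le_normd l x : dw w x -> uniq l -> lsum w 0 l x <= normd w x.
Proof.
move=> [x0 cx] ul; have [b xb] := cvg0_bounded x0.
apply: le_trans (lsum_le_rearr hw xb ul) _.
have := nondecreasing_cvgn_le (rearr_series_nd xb) cx (size l).
by rewrite {1}/series /= big_mkord.
Qed.

Lemma normd_lt_lsum K x : dw w x -> K < normd w x ->
  exists2 l, uniq l & K < lsum w 0 l x.
Proof.
move=> dx Kx; apply: contrapT => H.
have [|_] := @lsum_bounded_dw K x; last by rewrite leNgt Kx.
by move=> l ul; rewrite leNgt; apply/negP => Kl; apply: H; exists l.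
Qed.

Lemma normd_ge0 x : dw w x -> 0 <= normd w x.
Proof. by move=> dx; exact: (lsum_le_normd (l := [::]) dx). Qed.

Lemma coord_le_normd x k : dw w x -> `|x k| <= normd w x.
Proof.
by move=> dx; have := lsum_le_normd (l := [:: k]) dx isT; rewrite /= addr0 (weight0 hw) mul1r.
Qed.

Lemma dw_le x y : dw w y -> (forall k, `|x k| <= `|y k|) ->
  dw w x /\ normd w x <= normd w y.
Proof.
move=> dy xy; apply: lsum_bounded_dw => l ul; apply: le_trans (lsum_le_normd dy ul).
exact: (ler_lsum hw).
Qed.

Lemma dwD x y : dw w x -> dw w y -> dw w (fun k => x k + y k) /\
  normd w (fun k => x k + y k) <= normd w x + normd w y.
Proof.
move=> dx dy; apply: lsum_bounded_dw => l ul.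
by apply: le_trans (lsumD hw _ _ _ _) _; rewrite lerD // lsum_le_normd.
Qed.

Lemma dwZ a x : dw w x -> dw w (fun k => a * x k) /\
  normd w (fun k => a * x k) <= `|a| * normd w x.
Proof.
move=> dx; apply: lsum_bounded_dw => l ul.
by rewrite lsumZ ler_wpM2l // lsum_le_normd.
Qed.

Lemma dw0 : dw w (fun _ => 0) /\ normd w (fun _ => 0) <= 0.
Proof.
apply: lsum_bounded_dw => l ul.
by apply: le_trans (lsum_bounded hw _ (s := 0) _) _; rewrite ?mulr0 // => k; rewrite normr0.
Qed.

Lemma dwB x y : dw w x -> dw w y -> dw w (fun k => x k - y k) /\
  normd w (fun k => x k - y k) <= normd w x + normd w y.
Proof.
move=> dx dy; apply: lsum_bounded_dw => l ul.
apply: (@le_trans _ _ (lsum w 0 l x + lsum w 0 l (fun k => - y k))).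
  exact: (lsumD hw).
rewrite lerD ?lsum_le_normd //; apply: le_trans (lsum_le_normd dy ul).
by apply: (ler_lsum hw) => k; rewrite normrN.
Qed.

(* A list [l] almost norming [x] can be continued by any list disjoint from
   it, so all such continuations contribute little beyond position [size l];
   the first [size l] positions are small because [x] is a null sequence. *)
Lemma normd_tail x e : dw w x -> 0 < e ->
  exists M, forall l, uniq l -> (forall k, k \in l -> (M <= k)%N) -> lsum w 0 l x <= e.
Proof.
move=> dx e0; have e20 : 0 < e / 2 by rewrite divr_gt0.
have [|l ul Hl] := @normd_lt_lsum (normd w x - e / 2) x dx; first by rewrite ltrBlDr ltrDl.
have [N lN] := seq_bound l; have [x0 _] := dx.
have s0 : 0 < e / 2 / (size l).+1%:R by rewrite divr_gt0.
have [N' _ HN'] := (cvgr0Pnorm_lt _).1 x0 _ s0.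
exists (maxn N N') => l' ul' l'M.
have l'E := cat_take_drop (size l) l'.
rewrite -l'E lsum_cat [leRHS]splitr lerD //.
  apply: (@le_trans _ _ ((size l).+1%:R * (e / 2 / (size l).+1%:R))); last first.
    by rewrite mulrC divfK // pnatr_eq0.
  apply: le_trans (lsum_bounded hw _ _) _ => [k /mem_take kl|].
    by apply/ltW/HN' => /=; have := l'M _ kl; rewrite geq_max => /andP[].
  rewrite ler_wpM2r ?(ltW s0) // ler_nat size_take_min.
  by rewrite (leq_trans (geq_minl _ _)).
have ucat : uniq (l ++ drop (size l) l').
  rewrite cat_uniq ul drop_uniq // andbT /=; apply/hasPn => k /mem_drop /l'M.
  rewrite geq_max => /andP[Nk _]; apply/negP => /lN; by rewrite ltnNge Nk.
have := lsum_le_normd dx ucat; rewrite lsum_cat add0n => H.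
apply: (@le_trans _ _ (lsum w (size l) (drop (size l) l') x)).
  have [ll'|ll'] := leqP (size l) (size l'); first by rewrite size_takel // add0n.
  by rewrite drop_oversize // ltnW.
lra.
Qed.

End LorentzNorm.

(** * Cluster points and dependent choice *)

Section Compactness.
Variable R : realType.

(** The limit is the supremum of the levels [r] with [r <= u k] for [G]-almost all [k]. Above this
    supremum the level sets are not in [G], so their complements are. *)
Lemma ultra_bounded_limit (G : set_system nat) (u : nat -> R) K : UltraFilter G ->
  (forall k, `|u k| <= K) ->
  exists a, forall e, 0 < e -> G [set k | `|u k - a| < e].
Proof.
move=> GU uK; pose S := [set r : R | G [set k | r <= u k]].
have SK : ubound S K.
  move=> r Sr; rewrite leNgt; apply/negP => Kr.
  have [k /= rk] := filter_ex Sr.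
  by have := lt_le_trans Kr (le_trans rk (ler_norm _)); rewrite ltNge uK.
have S0 : S !=set0.
  exists (- K); rewrite /S /=; apply: filterS filterT => k _ /=.
  by rewrite lerNl (le_trans _ (uK k)) // -normrN ler_norm.
have hS : has_sup S by split => //; exists K.
exists (sup S) => e e0.
have [r Sr er] := sup_adherent e0 hS.
have GC : G (~` [set k | sup S + e <= u k]).
  have [Ge|//] := in_ultra_setVsetC [set k | sup S + e <= u k] GU.
  have := ub_le_sup (ex_intro _ K SK) Ge.
  by rewrite gerDl leNgt e0.
apply: filterS (filterI Sr GC) => k [/= rk /negP]; rewrite -ltNge => uk.
by rewrite ltr_distl uk andbT (lt_le_trans er rk).
Qed.

(** One ultrafilter finer than [\oo] makes all coordinates converge at once, which replaces a
    diagonal extraction. *)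
Lemma pointwise_cluster (t : nat -> nat -> R) K : (forall k i, `|t k i| <= K) ->
  exists z : nat -> R, forall N M e, 0 < e ->
    exists2 k, (N <= k)%N & forall i, (i < M)%N -> `|t k i - z i| < e.
Proof.
move=> tK; have [G [GU sG]] := @ultraFilterLemma nat \oo _.
have /choice[z Hz] : forall i, exists a, forall e, 0 < e -> G [set k | `|t k i - a| < e].
  by move=> i; exact: (ultra_bounded_limit GU (tK ^~ i)).
exists z => N M e e0.
have GM : G [set k | forall i, (i < M)%N -> `|t k i - z i| < e].
  elim: M => [|M IH]; first by apply: filterS filterT.
  apply: filterS (filterI IH (Hz M _ e0)) => k [/= H1 H2] i.
  by rewrite ltnS leq_eqVlt => /predU1P[->//|/H1].
have GN : G [set k | (N <= k)%N] by apply: sG; exists N.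
by have [k [/= kM kN]] := filter_ex (filterI GM GN); exists k.
Qed.

(* Dependent choice for sequences whose constraints involve the whole initial
   segment chosen so far. *)
Lemma history_choice (V : Type) (v : V) (P : nat -> (nat -> V) -> Prop) :
  (forall n X Y, (forall m, (m < n)%N -> X m = Y m) -> P n X -> P n Y) ->
  P 0%N (fun _ => v) ->
  (forall n X, P n X -> exists x, P n.+1 (fun m => if m == n then x else X m)) ->
  exists X, forall n, P n X.
Proof.
move=> Pext P0 PS.
have /choice[f Hf] (nX : nat * (nat -> V)) : exists x, P nX.1 nX.2 ->
    P nX.1.+1 (fun m => if m == nX.1 then x else nX.2 m).
  have [/PS[x Hx]|nP] := pselect (P nX.1 nX.2); first by exists x.
  by exists v.
pose st := fix st n : nat -> V :=
  if n is m.+1 then (fun i => if i == m then f (m, st m) else st m i) else fun _ => v.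
have Pst n : P n (st n) by elim: n => //= n /(Hf (n, st n)).
have st_stable d n m : (m < n)%N -> st (n + d)%N m = st n m.
  move=> mn; elim: d => [|d IH]; first by rewrite addn0.
  by rewrite addnS /= ltn_eqF // (leq_trans mn) // leq_addr.
(* Entry [m] is set at stage [m.+1] and never altered, so this diagonal agrees with [st n] below
   [n]. *)
exists (fun m => st m.+1 m) => n; apply: Pext (Pst n) => m mn.
by rewrite -(subnKC mn) st_stable.
Qed.

End Compactness.

(** * Linear combinations and bounded operators *)

Section Operators.
Variable R : realType.

Definition comb n (a : nat -> R) (X : nat -> nat -> R) : nat -> R :=
  fun k => \sum_(m < n) a m * X m k.

Lemma comb0 a X : comb 0 a X = fun _ => 0.
Proof. by apply/funext => k; rewrite /comb big_ord0. Qed.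

Lemma combS n a X : comb n.+1 a X = fun k => a n * X n k + comb n a X k.
Proof. by apply/funext => k; rewrite /comb big_ord_recr /= addrC. Qed.

Lemma eq_comb n a b X Y : (forall m, (m < n)%N -> a m = b m /\ X m = Y m) ->
  comb n a X = comb n b Y.
Proof.
move=> H; apply/funext => k; apply: eq_bigr => i _.
by have [-> ->] := H i (ltn_ord i).
Qed.

Lemma comb_widen n m a X : (n <= m)%N ->
  comb n a X = comb m (fun i => if (i < n)%N then a i else 0) X.
Proof.
move=> nm; apply/funext => k; rewrite /comb.
rewrite (big_ord_widen m (fun i => a i * X i k) nm) big_mkcond /=.
by apply: eq_bigr => i _; case: ifP => // _; rewrite mul0r.
Qed.

Lemma combD n b a a' X k :
  b * comb n a X k + comb n a' X k = comb n (fun i => b * a i + a' i) X k.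
Proof.
rewrite /comb mulr_sumr -big_split /=; apply: eq_bigr => i _.
by rewrite mulrDl mulrA.
Qed.

Section LinearMap.
Variables (D E : (nat -> R) -> Prop) (nD nE : (nat -> R) -> R).
Variable T : (nat -> R) -> nat -> R.
Hypothesis hT : is_op D nD E nE T.

Lemma op0 : D (fun _ => 0) -> T (fun _ => 0) = fun _ => 0.
Proof.
move=> D0; have [_ [Tlin _]] := hT; have := Tlin 1 _ _ D0 D0.
under eq_fun do rewrite mulr0 addr0.
move=> /(congr1 (fun f k => f k - T (fun _ => 0) k)) H.
apply/funext => k; have := congr1 (@^~ k) H; rewrite /= subrr mul1r addrK; exact: esym.
Qed.

Lemma opZ a x : D (fun _ => 0) -> D x -> T (fun k => a * x k) = fun k => a * T x k.
Proof.
move=> D0 Dx; have [_ [Tlin _]] := hT; have := Tlin a _ _ Dx D0.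
rewrite op0 //.
under eq_fun do rewrite addr0.
by move=> ->; apply/funext => k; rewrite addr0.
Qed.

Lemma opB x y : D x -> D y -> T (fun k => x k - y k) = fun k => T x k - T y k.
Proof.
move=> Dx Dy; have [_ [Tlin _]] := hT; have := Tlin (-1) _ _ Dy Dx.
under eq_fun do rewrite mulN1r addrC.
by move=> ->; apply/funext => k; rewrite mulN1r addrC.
Qed.

Lemma op_bound : (forall x, D x -> 0 <= nD x) ->
  exists2 K, 0 <= K & forall x, D x -> nE (T x) <= K * nD x.
Proof.
move=> D0; have [_ [_ [C HC]]] := hT; exists `|C|=> // x Dx.
by apply: le_trans (HC _ Dx) _; rewrite ler_wpM2r ?D0 // ler_norm.
Qed.

Lemma op_comb n a X : D (fun _ => 0) ->
  (forall b x y, D x -> D y -> D (fun k => b * x k + y k)) ->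
  (forall m, (m < n)%N -> D (X m)) ->
  D (comb n a X) /\ T (comb n a X) = comb n a (fun m => T (X m)).
Proof.
move=> D0 DL; have [_ [Tlin _]] := hT; elim: n => [|n IH] HX.
  by rewrite !comb0; split => //; exact: op0.
have [|Dn Tn] := IH; first by move=> m mn; apply: HX; exact: leqW.
have Xn := HX n (ltnSn n).
by rewrite !combS; split; [exact: DL | rewrite Tlin // Tn].
Qed.

End LinearMap.
End Operators.

(** * The gliding hump argument *)

Section GlidingHump.
Variables (R : realType) (w : nat -> R).
Hypothesis hw : is_weight w.
Let w_ge0 := weight_ge0 hw.
Implicit Types (x y : nat -> R) (l : seq nat).

Lemma dw_lin b x y : dw w x -> dw w y -> dw w (fun k => b * x k + y k).
Proof.
move=> dx dy; have [bx _] := dwZ hw b dx.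
by have [] := dwD hw bx dy.
Qed.

Lemma dw_comb n a (X : nat -> nat -> R) :
  (forall m, (m < n)%N -> dw w (X m) /\ normd w (X m) <= 1) ->
  dw w (comb n a X) /\ normd w (comb n a X) <= \sum_(m < n) `|a m|.
Proof.
elim: n => [|n IH] HX; first by rewrite comb0 big_ord0; exact: (dw0 hw).
have [|d1 n1] := IH; first by move=> m mn; apply: HX; exact: leqW.
have [dX nX] := HX n (ltnSn n).
have [d2 n2] := dwZ hw (a n) dX.
have [d3 n3] := dwD hw d2 d1.
rewrite combS big_ord_recr /=; split => //.
apply: le_trans n3 _; rewrite addrC lerD //; apply: le_trans n2 _.
by rewrite ler_piMr.
Qed.

Lemma lsum_comb m l n a (X : nat -> nat -> R) s :
  (forall i, (i < n)%N -> lsum w m l (X i) <= s) ->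
  lsum w m l (comb n a X) <= s * \sum_(i < n) `|a i|.
Proof.
elim: n => [|n IH] HX.
  by rewrite comb0 big_ord0 mulr0 lsum0.
rewrite combS big_ord_recr /= mulrDr addrC.
apply: le_trans (lsumD hw _ _ _ _) _; rewrite lerD //.
  by rewrite lsumZ mulrC ler_wpM2r // HX.
by apply: IH => i ni; apply: HX; exact: leqW.
Qed.

Lemma lsum_add_ge m l b x y :
  lsum w m l y - `|b| * lsum w m l x <= lsum w m l (fun k => b * x k + y k).
Proof.
rewrite lerBlDr -normrN -lsumZ; apply: le_trans (lsumD hw _ _ _ _).
by apply: (ler_lsum hw) => k _; rewrite mulNr addrAC subrr add0r.
Qed.

Variable T : (nat -> R) -> nat -> R.
Hypothesis hT : is_op (dw w) (normd w) (dw w) (normd w) T.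

(** A lower l_1-estimate witnessed by a single list [L] for all coefficients. Since [L] does not
    depend on [a], the next hump can be placed beyond it. *)
Definition lower_ell1 (b : R) n (X : nat -> nat -> R) (L : seq nat) :=
  forall a : nat -> R, b * \sum_(m < n) `|a m| <= lsum w 0 L (comb n a (fun m => T (X m))).

Lemma uniform_tail n (t : nat -> nat -> R) e : 0 < e ->
  (forall m, (m < n)%N -> dw w (t m)) ->
  exists M, forall l, uniq l -> (forall k, k \in l -> (M <= k)%N) ->
    forall m, (m < n)%N -> lsum w 0 l (t m) <= e.
Proof.
move=> e0; elim: n => [|n IH] dt; first by exists 0%N.
have [|M HM] := IH; first by move=> m mn; apply: dt; exact: leqW.
have [M' HM'] := normd_tail hw (dt n (ltnSn n)) e0.
exists (maxn M M') => l ul lM m; rewrite ltnS leq_eqVlt => /predU1P[->|mn].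
  by apply: HM' => // k /lM; rewrite geq_max => /andP[].
by apply: HM => // k /lM; rewrite geq_max => /andP[].
Qed.

(* The part of a flat vector [y] living beyond [M], measured with weights
   shifted by [N], still carries almost all of its norm. *)
Lemma hump_far_away y l0 d c N M : uniq l0 -> (forall k, `|y k| <= d) ->
  c <= lsum w 0 l0 y ->
  exists l, [/\ uniq l, forall k, k \in l -> (M <= k)%N &
    c - (N + M)%:R * d <= lsum w N l y].
Proof.
move=> ul0 yd cl0; pose l1 := [seq k <- l0 | (M <= k)%N].
have d0 : 0 <= d by apply: le_trans (yd 0%N).
(* Removing the entries below [M] loses at most [M * d]. Dropping the first [N] survivors loses at
   most [N * d] and pays for starting at position [N]. *)
exists (drop N l1); split; first by rewrite drop_uniq // filter_uniq.
  by move=> k /mem_drop; rewrite mem_filter => /andP[].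
have H1 := lsum_filter hw (leq M) 0 l0 y.
have H2 : lsum w 0 [seq k <- l0 | ~~ (M <= k)%N] y <= M%:R * d.
  apply: le_trans (lsum_bounded hw _ (s := d) _) _ => //.
  rewrite ler_wpM2r // ler_nat -[leqRHS](size_iota 0); apply: uniq_leq_size.
    exact: filter_uniq.
  by move=> k; rewrite mem_filter mem_iota -ltnNge add0n => /andP[].
have H3 : lsum w 0 l1 y <= N%:R * d + lsum w N (drop N l1) y.
  rewrite -{1}(cat_take_drop N l1) lsum_cat add0n lerD //.
    apply: le_trans (lsum_bounded hw _ (s := d) _) _ => //.
    by rewrite ler_wpM2r // ler_nat size_take_min geq_minl.
  have [Nl|lN] := leqP N (size l1); first by rewrite size_takel.
  by rewrite drop_oversize // ltnW.
rewrite natrD mulrDl; move: cl0 H1 H2 H3; rewrite -/l1; lra.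
Qed.

Variable c : R.
Hypothesis c_gt0 : 0 < c.
Hypothesis flat_images : forall d, 0 < d -> exists x, [/\ dw w x, normd w x <= 1 &
  exists y l, [/\ uniq l, c <= lsum w 0 l y & forall k, 0 <= y k <= T x k /\ y k <= d]].

Lemma flat_sequence : exists (x : nat -> nat -> R) (z : nat -> R),
  [/\ forall k, dw w (x k) /\ normd w (x k) <= 1,
      forall k, exists y l, [/\ uniq l, c <= lsum w 0 l y &
        forall i, 0 <= y i <= T (x k) i /\ y i <= k.+1%:R^-1],
      dw w z &
      forall N M e, 0 < e -> exists2 k, (N <= k)%N &
        forall i, (i < M)%N -> `|T (x k) i - z i| < e].
Proof.
have d_gt0 k : 0 < k.+1%:R^-1 :> R by rewrite invr_gt0.
have /choice[x Hx] := fun k => flat_images (d_gt0 k).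
have [K K0 TK] := op_bound hT (@normd_ge0 _ _ hw); have [Tdw _] := hT.
have dx k : dw w (x k) /\ normd w (x k) <= 1 by have [] := Hx k.
have nT k : normd w (T (x k)) <= K.
  have [dk nk] := dx k; apply: le_trans (TK _ dk) _; exact: ler_piMr.
have [k i|z Hz] := @pointwise_cluster R (fun k => T (x k)) K.
  by apply: le_trans (nT k); apply: coord_le_normd => //; apply: Tdw; case: (dx k).
exists x, z; split => //; first by move=> k; have [] := Hx k.
suff [] : dw w z /\ normd w z <= K + 1 by [].
apply: (lsum_bounded_dw hw) => l ul; have [M lM] := seq_bound l.
(* With this coordinatewise error the sum over [l] changes by at most 1, whence the bound [K + 1]
   for [z]. *)
have e0 : 0 < (size l).+1%:R^-1 :> R by [].
have [k _ kz] := Hz 0%N M _ e0.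
apply: (@le_trans _ _ (lsum w 0 l (T (x k)) + lsum w 0 l (fun i => z i - T (x k) i))).
  apply: le_trans (lsumD hw _ _ _ _); apply: (ler_lsum hw) => i _.
  by rewrite addrC subrK.
rewrite lerD //.
  by apply: le_trans (nT k); apply: lsum_le_normd => //; apply: Tdw; case: (dx k).
apply: le_trans (lsum_bounded hw _ (s := (size l).+1%:R^-1) _) _.
  by move=> i /lM /kz /ltW; rewrite distrC.
by rewrite ler_pdivrMr // mul1r ler_nat.
Qed.

(** The new image is close to [z] on [L], so there it disturbs the old estimate by at most
    [c / 2 - b + e] times its coefficient. On a far list [l] it gains at least [3c/4], while the
    older images contribute at most [e] each. The bound on [z] along the list is carried along so
    that the step can be repeated. *)
Lemma extend_lower_ell1 (x : nat -> nat -> R) (z : nat -> R) n (X : nat -> nat -> R) L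
    (b e : R) :
  (forall k, dw w (x k) /\ normd w (x k) <= 1) ->
  (forall k, exists y l, [/\ uniq l, c <= lsum w 0 l y &
     forall i, 0 <= y i <= T (x k) i /\ y i <= k.+1%:R^-1]) ->
  dw w z ->
  (forall N M e, 0 < e -> exists2 k, (N <= k)%N &
     forall i, (i < M)%N -> `|T (x k) i - z i| < e) ->
  0 < e -> uniq L -> lower_ell1 b n X L -> lsum w 0 L z <= c / 2 - b ->
  (forall m, (m < n)%N -> dw w (X m)) ->
  exists k L', [/\ uniq L', lsum w 0 L' z <= c / 2 - (b - e) &
    lower_ell1 (b - e) n.+1 (fun m => if m == n then x k else X m) L'].
Proof.
move=> dx hx dz xz e0 uL low Lz dX.
have [Tdw _] := hT.
have [M0 LM0] := seq_bound L; pose N := size L.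
have [M1 HM1] := normd_tail hw dz e0.
have [M2 HM2] := uniform_tail e0 (fun m mn => Tdw _ (dX m mn)).
(* Beyond [M0] a list is disjoint from [L]; beyond [M1] the vector [z] has sum at most [e], and
   beyond [M2] so do the earlier images. *)
pose M := maxn M0 (maxn M1 M2).
have e'0 : 0 < e / N.+1%:R by rewrite divr_gt0.
(* For [k >= K0] the flatness [1 / (k + 1)] makes the loss in [hump_far_away] at most [c / 4], so
   [3c/4] survives. *)
pose K0 := Num.truncn ((N + M)%:R * 4 / c).
have [k Kk kz] := xz K0 M0 _ e'0.
have [y [l0 [ul0 cl0 Hy]]] := hx k.
have yd i : `|y i| <= k.+1%:R^-1 by have [/andP[y0 _] ?] := Hy i; rewrite ger0_norm.
have [l [ul lM Hl]] := hump_far_away N M ul0 yd cl0.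
have small : (N + M)%:R / k.+1%:R <= c / 4.
  have kK : (N + M)%:R * 4 / c <= k.+1%:R.
    apply: ltW; apply: lt_le_trans (truncnS_gt _) _.
    by rewrite ler_nat ltnS.
  rewrite ler_pdivrMr //; rewrite ler_pdivrMr // in kK.
  by rewrite -[leRHS]mulrA (mulrC 4^-1) mulrA ler_pdivlMr // (mulrC c).
have lM0 i : i \in l -> (M0 <= i)%N by move=> /lM; rewrite !geq_max => /and3P[].
have lM1 i : i \in l -> (M1 <= i)%N by move=> /lM; rewrite !geq_max => /and3P[].
have lM2 i : i \in l -> (M2 <= i)%N by move=> /lM; rewrite !geq_max => /and3P[].
have yT : lsum w N l y <= lsum w N l (T (x k)).
  apply: (ler_lsum hw) => i _; have [/andP[y0 yT] _] := Hy i.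
  by rewrite !ger0_norm // (le_trans y0).
have LT : lsum w 0 L (T (x k)) <= lsum w 0 L z + e.
  apply: (@le_trans _ _ (lsum w 0 L z + lsum w 0 L (fun i => T (x k) i - z i))).
    apply: le_trans (lsumD hw _ _ _ _); apply: (ler_lsum hw) => i _.
    by rewrite addrC subrK.
  rewrite lerD2l; apply: le_trans (lsum_bounded hw _ (s := e / N.+1%:R) _) _.
    by move=> i /LM0 /kz /ltW.
  by rewrite mulrA ler_pdivrMr // mulrC ler_wpM2l ?(ltW e0) // ler_nat leqnSn.
exists k, (L ++ l); split.
- rewrite cat_uniq uL ul andbT; apply/hasPn => i /lM0 iM; apply/negP => /LM0.
  by rewrite ltnNge iM.
- rewrite lsum_cat add0n; have := HM1 l ul lM1.
  have := lsum_shift hw l z (leq0n N); rewrite -/N; lra.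
move=> a; rewrite combS big_ord_recr /= eqxx.
have -> : comb n a (fun m => T (if m == n then x k else X m)) =
    comb n a (fun m => T (X m)).
  by apply: eq_comb => m mn; rewrite ltn_eqF.
rewrite lsum_cat add0n -/N.
set u := comb n a _; set S := \sum_(i < n) _.
have uS : lsum w N l u <= e * S.
  apply: lsum_comb => i ni; apply: le_trans (HM2 l ul lM2 _ ni).
  exact: (lsum_shift hw).
have H1 := lsum_add_ge 0 L (a n) (T (x k)) u.
have H2 : `|a n| * lsum w N l (T (x k)) - lsum w N l u <=
    lsum w N l (fun i => a n * T (x k) i + u i).
  rewrite lerBlDr -lsumZ -[X in _ + X](_ : lsum w N l (fun i => -1 * u i) = _).
    apply: le_trans (lsumD hw _ _ _ _); apply: (ler_lsum hw) => i _.
    by rewrite mulN1r addrK.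
  by rewrite lsumZ normrN1 mul1r.
have lowu : b * S <= lsum w 0 L u := low a.
have P1 : `|a n| * lsum w 0 L (T (x k)) <= `|a n| * (c / 2 - b + e).
  by rewrite ler_wpM2l // (le_trans LT) // lerD2r.
have P2 : `|a n| * (c * 3 / 4) <= `|a n| * lsum w N l (T (x k)).
  rewrite ler_wpM2l // (le_trans _ yT) // (le_trans _ Hl) //.
  move: small; set q := (_ / _); move=> small.
  lra.
(* The pieces over [L] and [l] add up to at least [(b - e) * S + |a n| * (c / 4 + b - e)], and the
   extra [|a n| * c / 4] is discarded. *)
have P3 : 0 <= `|a n| * c by rewrite mulr_ge0 // ltW.
nra.
Qed.

Lemma not_strictly_singular_of_flat_images : ~ strictly_singular w T.
Proof.
have [x [z [dx hx dz xz]]] := flat_sequence.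
(* [b 0 = 3c/8] is below [c / 2], as the empty list requires. Strict decrease leaves a positive
   error for every extension, and [b n >= c / 4] gives the final constant. *)
pose b n : R := c / 4 + c / 8 / 2 ^+ n.
have bS n : 0 < b n - b n.+1.
  rewrite /b opprD addrACA subrr add0r subr_gt0 ltr_pM2l ?divr_gt0 //.
  by rewrite ltf_pV2 ?posrE ?exprn_gt0 // exprS ltr_pMl ?exprn_gt0 // ltr1n.
have b_ge n : c / 4 <= b n by rewrite lerDl divr_ge0 ?exprn_ge0 // divr_ge0 // ltW.
pose P n (X : nat -> nat -> R) := (forall m, (m < n)%N -> dw w (X m) /\ normd w (X m) <= 1) /\
  exists L : seq nat, [/\ uniq L, lower_ell1 (b n) n X L & lsum w 0 L z <= c / 2 - b n].
have [X HX] : exists X, forall n, P n X.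
  apply: (@history_choice _ (fun _ => 0)).
  - move=> n X Y XY [dX [L [uL low Lz]]]; split; first by move=> m mn; rewrite -XY //; exact: dX.
    exists L; split => // a.
    have <- : comb n a (fun m => T (X m)) = comb n a (fun m => T (Y m)) by
      apply: eq_comb => m mn; rewrite XY.
    exact: low.
  - split => //; exists [::]; split => //= [a|].
      by rewrite big_ord0 mulr0.
    by rewrite /b expr0 divr1; have := c_gt0; lra.
  - move=> n X [dX [L [uL low Lz]]].
    have dX' m : (m < n)%N -> dw w (X m) by move=> /dX[].
    have [k [L' [uL' Lz' low']]] := extend_lower_ell1 dx hx dz xz (bS n) uL low Lz dX'.
    have Eb : b n - (b n - b n.+1) = b n.+1 by ring.
    rewrite Eb in Lz' low'.
    exists (x k); split; last by exists L'.
    by move=> m; rewrite ltnS leq_eqVlt; case: eqP => //= _; exact: dX.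
have dX m : dw w (X m) /\ normd w (X m) <= 1 by have [H _] := HX m.+1; exact: H.
have dC n (a : nat -> R) : dw w (comb n a X) /\ normd w (comb n a X) <= \sum_(m < n) `|a m|.
  by apply: dw_comb => m _.
have [Tdw _] := hT; have [d0 n0] := dw0 hw.
have TC n (a : nat -> R) : T (comb n a X) = comb n a (fun m => T (X m)).
  by have [] := op_comb hT a d0 dw_lin (fun m (_ : (m < n)%N) => (dX m).1).
have low n (a : nat -> R) : c / 4 * (\sum_(m < n) `|a m|) <= normd w (T (comb n a X)).
  have [_ [L [uL lowL _]]] := HX n.
  apply: le_trans (lsum_le_normd hw (Tdw _ (dC n a).1) uL); rewrite TC.
  by apply: le_trans (lowL a); rewrite ler_wpM2r // sumr_ge0.
(* The closed linear span of the [X m] in [dw w]. *)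
pose M (u : nat -> R) := dw w u /\ forall e, 0 < e -> exists n (a : nat -> R),
  normd w (fun k => u k - comb n a X k) < e.
have MC n (a : nat -> R) : M (comb n a X).
  split; first exact: (dC n a).1.
  move=> e e0; exists n, a; under eq_fun do rewrite subrr.
  exact: le_lt_trans e0.
have Msub : subspace_d w M.
  split; first by move=> u [].
  split; first by have := MC 0%N (fun _ => 0); rewrite comb0.
  move=> a u v [du Hu] [dv Hv]; split; first exact: dw_lin.
  move=> e e0; have e20 : 0 < e / 2 by rewrite divr_gt0.
  have a1 : 0 < `|a| + 1 by rewrite ltr_wpDl.
  have [n [p Hp]] := Hu _ (divr_gt0 e20 a1); have [m [q Hq]] := Hv _ e20.
  have [p' Ep] : exists p', comb n p X = comb (maxn n m) p' X.
    by eexists; apply: comb_widen; exact: leq_maxl.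
  have [q' Eq] : exists q', comb m q X = comb (maxn n m) q' X.
    by eexists; apply: comb_widen; exact: leq_maxr.
  rewrite Ep in Hp; rewrite Eq in Hq.
  exists (maxn n m), (fun i => a * p' i + q' i).
  have [d1 _] := dwB hw du (dC (maxn n m) p').1.
  have [d2 _] := dwB hw dv (dC (maxn n m) q').1.
  have [d3 n3] := dwZ hw a d1; have [d4 n4] := dwD hw d3 d2.
  rewrite (_ : (fun k => _) = (fun k => a * (u k - comb (maxn n m) p' X k) +
    (v k - comb (maxn n m) q' X k))); last first.
    by apply/funext => k; rewrite -combD; ring.
  apply: le_lt_trans n4 _; rewrite [ltRHS]splitr ler_ltD //; apply: le_trans n3 _.
  apply: (@le_trans _ _ ((`|a| + 1) * (e / 2 / (`|a| + 1)))); last first.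
    by rewrite mulrC divfK // gt_eqF.
  by rewrite ler_pM // ?normd_ge0 // ?lerDl // ltW.
have Mclosed : closed_d w M.
  move=> u du Hu; split => // e e0; have e20 : 0 < e / 2 by rewrite divr_gt0.
  have [v [[dv Hv] uv]] := Hu _ e20; have [n [a Ha]] := Hv _ e20.
  exists n, a; have [d1 _] := dwB hw du dv; have [d2 _] := dwB hw dv (dC n a).1.
  have [_ H] := dwD hw d1 d2.
  rewrite (_ : (fun k => _) = fun k => (u k - v k) + (v k - comb n a X k)); last first.
    by apply/funext => k; ring.
  by apply: le_lt_trans H _; rewrite [ltRHS]splitr ltrD.
have Minf : infinite_dim M.
  move=> n; exists (fun i => X i); split.
    move=> i; rewrite (_ : X i = comb i.+1 (fun m => (m == i)%:R) X) //.
    apply/funext => k; rewrite /comb big_ord_recr /= eqxx mul1r big1 ?add0r //.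
    by move=> j _; rewrite ltn_eqF // mul0r.
  move=> p Hp i; pose a (m : nat) := oapp p 0 (insub m).
  have ap (j : 'I_n) : a j = p j by rewrite /a valK.
  have Ca : comb n a X = fun _ => 0.
    by rewrite -Hp; apply/funext => k; apply: eq_bigr => j _; rewrite ap.
  (* A vanishing combination has image 0, so the lower estimate forces the sum of the [|a m|] to be
     at most 0. *)
  have := low n a; rewrite Ca (op0 hT d0) => /le_trans/(_ n0).
  rewrite pmulr_rle0 ?divr_gt0 // => S0.
  apply/eqP; rewrite -normr_le0 -ap; apply: le_trans S0.
  by rewrite (bigD1 i) //= lerDl sumr_ge0.
move=> /(_ M Msub Mclosed Minf); apply.
have [K K0 TK] := op_bound hT (@normd_ge0 _ _ hw).
exists (c / 4); split; first by rewrite divr_gt0.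
move=> u [du Hu]; apply/ler_addgt0Pr => e e0.
(* Replacing [u] by a combination at distance [s] costs [K * s] through [T] and [c / 4 * s] through
   the norm of [u], hence the tolerance [e / (K + c / 4)]. *)
have Kc : 0 < K + c / 4 by rewrite ltr_wpDl // divr_gt0.
have [n [a Ha]] := Hu _ (divr_gt0 e0 Kc).
have [dCa nCa] := dC n a; have [d1 _] := dwB hw du dCa.
have nu : normd w u <= normd w (comb n a X) + normd w (fun k => u k - comb n a X k).
  have [_] := dwD hw dCa d1; under eq_fun do rewrite addrC subrK; exact.
have nT : normd w (T (comb n a X)) <=
    normd w (T u) + K * normd w (fun k => u k - comb n a X k).
  have [_] := dwB hw (Tdw _ du) (Tdw _ d1).
  rewrite (_ : (fun k => _) = T (comb n a X)).
    by move=> /le_trans; apply; rewrite lerD2l TK.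
  by apply/funext => k; rewrite (opB hT du dCa) opprB addrC subrK.
have := low n a; set s := normd w (fun k => u k - _) in Ha nu nT *.
have : (K + c / 4) * s <= e by rewrite mulrC -ler_pdivlMr // ltW.
have c4 : 0 < c / 4 by rewrite divr_gt0.
have := ler_wpM2l (ltW c4) nCa; have := ler_wpM2l (ltW c4) nu.
rewrite mulrDl mulrDr; lra.
Qed.

End GlidingHump.

(** * Pairing summable with bounded sequences *)

Section Pairing.
Variable R : realType.
Implicit Types (u v b : nat -> R).

Definition pairing u b : R := limn (series (fun i => u i * b i)).

Lemma cvg_pairing u b K : ell1 u -> (forall i, `|b i| <= K) ->
  cvgn (series (fun i => `|u i * b i|)).
Proof.
move=> cu bK; apply: (@series_le_cvg _ _ (fun i => K * `|u i|)) => [//|i|i|].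
- by rewrite mulr_ge0 // (le_trans _ (bK 0%N)).
- by rewrite normrM mulrC ler_wpM2r.
- exact: (is_cvg_seriesZ (f := fun i => `|u i|) (k := K) cu).
Qed.

Lemma is_cvg_pairing u b K : ell1 u -> (forall i, `|b i| <= K) ->
  cvgn (series (fun i => u i * b i)).
Proof. by move=> cu bK; apply: normed_cvg; exact: cvg_pairing cu bK. Qed.

Lemma ell1_norm u : ell1 u -> ell1 (fun i => `|u i|).
Proof. by rewrite /ell1; under [X in series X]eq_fun do rewrite -normr_id. Qed.

Lemma ell1_lin a u v : ell1 u -> ell1 v -> ell1 (fun i => a * u i + v i).
Proof.
move=> cu cv; apply: (@series_le_cvg _ _ (fun i => `|a| * `|u i| + `|v i|)) => //.
  by move=> i; rewrite -normrM ler_normD.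
apply: (is_cvg_seriesD (f := fun i => `|a| * `|u i|)) => //.
exact: (is_cvg_seriesZ (f := fun i => `|u i|) (k := `|a|) cu).
Qed.

Lemma pairing_lin a u v b K : ell1 u -> ell1 v -> (forall i, `|b i| <= K) ->
  pairing (fun i => a * u i + v i) b = a * pairing u b + pairing v b.
Proof.
move=> cu cv bK; rewrite /pairing.
have cub := is_cvg_pairing cu bK; have cvb := is_cvg_pairing cv bK.
rewrite -[a * _](lim_seriesZ a cub) -lim_seriesD //; last exact: is_cvg_seriesZ.
congr (limn (series _)); apply/funext => i /=; rewrite mulrDl -mulrA //.
Qed.

Lemma le_pairing u v b b' K K' : ell1 u -> ell1 v -> (forall i, `|b i| <= K) ->
  (forall i, `|b' i| <= K') -> (forall i, u i * b i <= v i * b' i) ->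
  pairing u b <= pairing v b'.
Proof.
move=> cu cv bK bK' H.
by apply: lim_series_le => //; [apply: is_cvg_pairing cu bK | apply: is_cvg_pairing cv bK'].
Qed.

Lemma pairingB u b b' K K' : ell1 u -> (forall i, `|b i| <= K) ->
  (forall i, `|b' i| <= K') ->
  pairing u b - pairing u b' = pairing u (fun i => b i - b' i).
Proof.
move=> cu bK bK'; have c1 := is_cvg_pairing cu bK; have c2 := is_cvg_pairing cu bK'.
rewrite /pairing -(lim_seriesB c1 c2).
by congr (limn (series _)); apply/funext => i /=; rewrite mulrBr.
Qed.

Lemma norm_pairing u b K : ell1 u -> (forall i, `|b i| <= K) ->
  `|pairing u b| <= pairing (fun i => `|u i|) (fun i => `|b i|).
Proof.
move=> cu bK; apply: le_trans (lim_series_norm (cvg_pairing cu bK)) _.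
by rewrite /pairing /normed_series_of; under [X in series X]eq_fun do rewrite normrM.
Qed.

Lemma pairing_const u K : ell1 u -> pairing (fun i => `|u i|) (fun _ => K) = K * norm1 u.
Proof.
move=> cu; rewrite /norm1 -[K * _](lim_seriesZ K cu) /pairing.
by congr (limn (series _)); apply/funext => i /=; rewrite mulrC.
Qed.

Lemma pairing_sum L u (b : nat -> nat -> R) K : ell1 u ->
  (forall i n, `|b i n| <= K) ->
  \sum_(n < L) pairing u (b ^~ n) = pairing u (fun i => \sum_(n < L) b i n).
Proof.
move=> cu bK.
have sumK n i : `|\sum_(j < n) b i j| <= n%:R * K.
  apply: le_trans (ler_norm_sum _ _ _) _.
  apply: (@le_trans _ _ (\sum_(j < n) K)); first by apply: ler_sum => j _; exact: bK.
  by rewrite sumr_const card_ord mulr_natl.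
elim: L => [|L IH].
  rewrite big_ord0; symmetry; apply: cvg_lim => //.
  have -> : series (fun i => u i * \sum_(n < 0) b i n) = cst 0; last exact: cvg_cst.
  by apply/funext => n; rewrite /series /= big1 // => i _; rewrite big_ord0 mulr0.
rewrite big_ord_recr /= IH.
have c1 := is_cvg_pairing cu (sumK L); have c2 := is_cvg_pairing cu (bK ^~ L).
rewrite /pairing -(lim_seriesD c1 c2).
by congr (limn (series _)); apply/funext => i /=; rewrite big_ord_recr /= mulrDr.
Qed.

Lemma norm1_ge0 u : ell1 u -> 0 <= norm1 u.
Proof. by move=> cu; apply: limr_ge => //; apply: nearW => n; apply: sumr_ge0. Qed.

Lemma ell1_finite N v : (forall k, (N <= k)%N -> v k = 0) ->
  ell1 v /\ norm1 v = \sum_(k < N) `|v k|.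
Proof.
move=> H; have E : \forall n \near \oo, series (fun k => `|v k|) n = \sum_(k < N) `|v k|.
  exists N => // n /= Nn; rewrite /series /= (big_cat_nat (leq0n N) Nn) /=.
  rewrite [X in _ + X]big_nat_cond [X in _ + X]big1 ?addr0 ?big_mkord // => k.
  by rewrite andbT => /andP[/H -> _]; rewrite normr0.
by split; [apply: is_cvg_near_cst E | apply: lim_near_cst E].
Qed.

Lemma ell1_tail N u : ell1 u -> let t := fun k => if (k < N)%N then 0 else u k in
  ell1 t /\ norm1 t = norm1 u - series (fun k => `|u k|) N.
Proof.
move=> cu t; pose h k := if (k < N)%N then u k else 0.
have [ch nh] : ell1 h /\ norm1 h = \sum_(k < N) `|h k|.
  by apply: ell1_finite => k Nk; rewrite /h ltnNge Nk.
have E : (fun k => `|t k|) = (fun k => `|u k|) - (fun k => `|h k|).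
  apply/funext => k; rewrite !fctE /t /h; case: ifP => _; first by rewrite normr0 subrr.
  by rewrite normr0 subr0.
rewrite /ell1 /norm1 E; split; first exact: is_cvg_seriesB.
rewrite lim_seriesB //; congr (_ - _); rewrite -/(norm1 h) nh /series /= big_mkord.
by apply: eq_bigr => i _; rewrite /h ltn_ord.
Qed.

End Pairing.

(** * Matrix representation of a positive operator on l_1 *)

Section OperatorFromEll1.
Variables (R : realType) (w : nat -> R).
Hypothesis hw : is_weight w.
Variable A : (nat -> R) -> nat -> R.
Hypothesis hA : is_op (@ell1 R) (@norm1 R) (dw w) (normd w) A.
Hypothesis A_pos : positive_op (@ell1 R) A.

Definition unitv (i k : nat) : R := (k == i)%:R.

Lemma ell1_unitv i : ell1 (unitv i) /\ norm1 (unitv i) = 1.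
Proof.
have [|c1 n1] := @ell1_finite R i.+1 (unitv i).
  by move=> k ik; rewrite /unitv gtn_eqF.
split => //; rewrite n1 big_ord_recr /= {2}/unitv eqxx normr1 big1 ?add0r // => j _.
by rewrite /unitv ltn_eqF // normr0.
Qed.

Lemma ell1_0 : ell1 (fun _ : nat => 0 : R).
Proof. by have [] := @ell1_finite R 0 (fun _ => 0). Qed.

Definition col i : nat -> R := A (unitv i).

Lemma col_bounds : exists2 K, 0 <= K & forall i,
  [/\ dw w (col i), normd w (col i) <= K & forall n, 0 <= col i n <= K].
Proof.
have [K K0 AK] := op_bound hA (@norm1_ge0 R); exists K => // i.
have [c1 n1] := ell1_unitv i; have [Adw _] := hA.
have ni : normd w (col i) <= K by have := AK _ c1; rewrite n1 mulr1.
split => // [|n]; first exact: Adw.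
have -> : 0 <= col i n by apply: A_pos => // k; rewrite ler0n.
by apply: le_trans ni; apply: le_trans (ler_norm _) _; exact/(coord_le_normd hw)/Adw.
Qed.

(** The difference between [A u n] and a partial sum is [A t n] for a tail [t] of [u]; it tends to 0
    because [A] is bounded and each coordinate is dominated by the norm. *)
Lemma opA_series u n : ell1 u -> A u n = pairing u (col ^~ n).
Proof.
move=> cu; symmetry; apply: cvg_lim => //.
have [K K0 AK] := op_bound hA (@norm1_ge0 R); have [Adw _] := hA.
apply/cvgrPdist_lt => e e0.
have K1 : 0 < K + 1 by rewrite ltr_wpDl.
have /cvgrPdist_lt/(_ _ (divr_gt0 e0 K1))[N _ HN] : series (fun k => `|u k|) @ \oo --> norm1 u.
  exact: cu.
exists N => // m /= /HN /= uN.
have [ct nt] := ell1_tail m cu; set t := fun k => _ in ct nt.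
have [cC AC] := op_comb hA u ell1_0 (@ell1_lin R) (fun i (_ : (i < m)%N) => (ell1_unitv i).1).
have utE : (fun k => u k - t k) = comb m u unitv.
  apply/funext => k; rewrite /t /comb /unitv; case: ifP => km.
    rewrite subr0 (bigD1 (Ordinal km)) //= eqxx mulr1 big1 ?addr0 // => j jk.
    by rewrite eq_sym (_ : (j == k :> nat) = false) ?mulr0 //; apply/negbTE.
  rewrite subrr big1 // => j _; rewrite gtn_eqF ?mulr0 //.
  by rewrite (leq_trans (ltn_ord j)) // leqNgt km.
have -> : A u n - series (fun i => u i * col i n) m = A t n.
  have := congr1 (@^~ n) (opB hA cu ct); rewrite utE AC /= /series /= big_mkord => E.
  by rewrite -[X in _ - X]/(comb m u col n) E opprB addrC subrK.
apply: le_lt_trans (coord_le_normd hw n (Adw _ ct)) _; apply: le_lt_trans (AK _ ct) _.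
rewrite nt; move: uN; rewrite ger0_norm; last by rewrite -nt norm1_ge0.
rewrite ltr_pdivlMr // mulrC; apply: le_lt_trans.
by rewrite ler_wpM2r ?lerDl // -nt norm1_ge0.
Qed.

(** * Truncating the matrix at level [d] *)

Section Truncation.
Variable d : R.
Hypothesis d_gt0 : 0 < d.

Definition big_part i n : R := if d <= col i n then col i n else 0.

Lemma big_part_bounds i n : 0 <= big_part i n /\ big_part i n <= col i n <= big_part i n + d.
Proof.
have [K _ /(_ i)[_ _ /(_ n)/andP[c0 _]]] := col_bounds.
rewrite /big_part; case: ifP => [_|/negbT]; first by rewrite c0 lexx lerDl ltW.
by rewrite -ltNge add0r lexx c0 => /ltW ->.
Qed.

(** More than [N] entries of size at least [d] would force a column norm of at least [d] times the
    [N]-th partial sum of [w], exceeding the common bound [K]. So each column has at most [N] of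
    them, each at most [K], with [N] independent of the column. *)
Lemma sum_big_part : exists2 C, 0 <= C & forall i L, \sum_(n < L) big_part i n <= C.
Proof.
have [K K0 HK] := col_bounds; have [N HN] := sum_weight_unbounded hw (K / d).
exists (N%:R * K); first by rewrite mulr_ge0.
move=> i L; have [di ni ci] := HK i.
pose l := [seq n <- iota 0 L | d <= col i n].
have ul : uniq l by rewrite filter_uniq ?iota_uniq.
have -> : \sum_(n < L) big_part i n = \sum_(n <- l) col i n.
  by rewrite -(big_mkord xpredT (big_part i)) /index_iota subn0 big_filter [RHS]big_mkcond.
apply: (@le_trans _ _ ((size l)%:R * K)).
  rewrite -sum1_size natr_sum mulr_suml; apply: ler_sum => n _.
  by rewrite mul1r; case/andP: (ci n).
rewrite ler_wpM2r // ler_nat leqNgt; apply/negP => Nl.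
have : d * (\sum_(j < size l) w j) <= K.
  apply: le_trans (le_trans (lsum_le_normd hw di ul) ni).
  apply: (lsum_ge_const hw) => n; rewrite mem_filter => /andP[dn _].
  by apply: le_trans dn (ler_norm _).
rewrite mulrC -ler_pdivlMr // leNgt => /negP; apply; apply: lt_le_trans HN _.
rewrite (big_ord_widen _ w (ltnW Nl)) [leRHS](bigID (fun j : 'I_(size l) => (j < N)%N)) /=.
by rewrite lerDl sumr_ge0 // => j _; exact: (weight_ge0 hw).
Qed.

Definition truncA u n : R := pairing u (big_part ^~ n).

Lemma big_part_norm_le : exists2 K, 0 <= K & forall i n, `|big_part i n| <= K.
Proof.
have [K K0 HK] := col_bounds; exists K => // i n.
have [b0 /andP[bc _]] := big_part_bounds i n; rewrite ger0_norm //.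
by have [_ _ /(_ n)/andP[_]] := HK i; apply: le_trans.
Qed.

(** Interchange the finite sum over rows with the series over columns, then bound each column sum by
    [sum_big_part]. *)
Lemma truncA_ell1 : exists2 C, 0 <= C & forall u, ell1 u ->
  ell1 (truncA u) /\ norm1 (truncA u) <= C * norm1 u.
Proof.
have [C C0 HC] := sum_big_part; have [K K0 HK] := big_part_norm_le.
exists C => // u cu; have cu' := ell1_norm cu.
have bound L : series (fun n => `|truncA u n|) L <= C * norm1 u.
  rewrite /series /= big_mkord -pairing_const //.
  apply: (@le_trans _ _ (\sum_(n < L) pairing (fun i => `|u i|) (big_part ^~ n))).
    apply: ler_sum => n _; apply: le_trans (norm_pairing cu (HK ^~ n)) _.
    apply: (le_pairing cu' cu' (K := K) (K' := K)) => i; rewrite ?normr_id //.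
    by rewrite [`|big_part _ _|]ger0_norm //; case: (big_part_bounds i n).
  rewrite (pairing_sum L cu' HK).
  have S0 i : 0 <= \sum_(n < L) big_part i n.
    by apply: sumr_ge0 => n _; case: (big_part_bounds i n).
  apply: (le_pairing cu' cu' (K := C) (K' := C)) => i.
  - by rewrite ger0_norm.
  - by rewrite ger0_norm.
  - by rewrite ler_wpM2l.
have ct : ell1 (truncA u).
  apply: nondecreasing_is_cvgn; last by exists (C * norm1 u) => _ [n _ <-].
  by apply: nondecreasing_series => i _ _; exact: normr_ge0.
by split => //; apply: limr_le => //; apply: nearW.
Qed.

(* What truncation discards from the columns of [A] is at most [d] in sup norm. *)
Lemma opA_sub_truncA u v : ell1 u -> ell1 v -> (forall i, `|v i| <= u i) -> forall n,
  [/\ `|A v n - truncA v n| <= A u n - truncA u n,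
      A u n - truncA u n <= A u n &
      A u n - truncA u n <= d * norm1 u].
Proof.
move=> cu cv vu n; have [K K0 HK] := col_bounds; have [K' K'0 HK'] := big_part_norm_le.
have u0 i : 0 <= u i by apply: le_trans (vu i).
have cK i : `|col i n| <= K.
  by have [_ _ /(_ n)/andP[c0 cK]] := HK i; rewrite ger0_norm.
have rb i : 0 <= col i n - big_part i n <= d.
  have [_ /andP[H1 H2]] := big_part_bounds i n.
  by rewrite subr_ge0 H1 lerBlDl.
have rd i : `|col i n - big_part i n| <= d by have /andP[? ?] := rb i; rewrite ger0_norm.
rewrite !opA_series // /truncA !(pairingB _ cK (HK' ^~ n)) //.
split.
- apply: le_trans (norm_pairing cv rd) _.
  apply: (le_pairing (ell1_norm cv) cu (K := d) (K' := d)) => i; rewrite ?normr_id //.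
  by have /andP[r0 _] := rb i; rewrite [`|_ - _|]ger0_norm // ler_wpM2r.
- apply: (le_pairing cu cu rd cK) => i; rewrite ler_wpM2l // gerBl.
  by case: (big_part_bounds i n).
- rewrite -pairing_const //.
  apply: (le_pairing cu (ell1_norm cu) (K := d) (K' := d)) => i //.
    by rewrite ger0_norm // ltW.
  by rewrite [`|u i|]ger0_norm // ler_wpM2l //; case/andP: (rb i).
Qed.

Lemma truncA_lin a u v : ell1 u -> ell1 v ->
  truncA (fun k => a * u k + v k) = fun n => a * truncA u n + truncA v n.
Proof.
move=> cu cv; apply/funext => n; have [K _ HK] := big_part_norm_le.
exact: (pairing_lin a cu cv (HK ^~ n)).
Qed.

End Truncation.
End OperatorFromEll1.

(** * From failure of approximation to flat images *)

Theorem theorem6p12 (R : realType) (w : nat -> R)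
  (hw1 : w 0%N = 1)
  (hwdec : forall m n : nat, (m <= n)%N -> w n <= w m)
  (hwlim : w @ \oo --> (0 : R))
  (hwsum : series w @ \oo --> +oo)
  (T A B : (nat -> R) -> (nat -> R))
  (hT : is_op (dw w) (normd w) (dw w) (normd w) T)
  (hTss : strictly_singular w T)
  (hA : is_op (@ell1 R) (@norm1 R) (dw w) (normd w) A)
  (hB : is_op (dw w) (normd w) (@ell1 R) (@norm1 R) B)
  (hApos : positive_op (@ell1 R) A)
  (hBpos : positive_op (dw w) B)
  (hTAB : forall x, dw w x -> T x = A (B x)) :
  in_closure_Jj w T.
Proof.
have hw : is_weight w by split.
move=> eps eps0; apply: contrapT => no_approx.
have [KB KB0 HKB] := op_bound hB (@normd_ge0 _ _ hw).
have [KT KT0 HKT] := op_bound hT (@normd_ge0 _ _ hw).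
have [Bell _] := hB; have [Tdw _] := hT.
(* The approximation gap [eps] serves as the constant [c] of the gliding hump. *)
apply: (not_strictly_singular_of_flat_images hw hT eps0) hTss => d d0.
have KB1 : 0 < KB + 1 by rewrite ltr_wpDl.
pose delta := d / (KB + 1); have delta0 : 0 < delta by rewrite divr_gt0.
(* [delta * KB <= d], so the discarded part of [A] applied to [B ax] will be at most [d * normd w x]
   in sup norm. *)
have [x [dx big]] : exists x, dw w x /\
    eps * normd w x < normd w (fun k => T x k - truncA A delta (B x) k).
  apply: contrapT => H; apply: no_approx.
  (* Were there no such [x], [truncA] after [B] followed by [j] and the identity would approximate
     [T] within [eps]. *)
  exists id, (fun x => truncA A delta (B x)); split; last split.
  - by split => //; split => //; exists 1 => x _; rewrite mul1r.
  - have [C C0 HC] := truncA_ell1 hw hA hApos delta0.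
    split; first by move=> x /Bell /HC [].
    split; last first.
      exists (C * KB) => x dx; have [_ H1] := HC _ (Bell _ dx).
      by apply: le_trans H1 _; rewrite -mulrA ler_wpM2l // HKB.
    move=> a x y dx dy; have [_ [Blin _]] := hB; rewrite Blin //.
    exact: (truncA_lin hw hA hApos delta0 a (Bell _ dx) (Bell _ dy)).
  - move=> x dx; rewrite leNgt; apply/negP => Hx; apply: H; exists x; split => //.
pose ax k := `|x k|.
have [dax nax] : dw w ax /\ normd w ax <= normd w x.
  by apply: (dw_le hw dx) => k; rewrite normr_id.
(* Positivity of [B] applied to [|x| - x] and [|x| + x]. *)
have Bax k : `|B x k| <= B ax k.
  have [_ [Blin _]] := hB.
  have H1 : 0 <= B (fun k => -1 * x k + ax k) k.
    by apply: hBpos => [|i]; [exact: dw_lin | rewrite mulN1r addrC subr_ge0 ler_norm].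
  have H2 : 0 <= B (fun k => 1 * x k + ax k) k.
    apply: hBpos => [|i]; first exact: dw_lin.
    by rewrite mul1r /ax -lerBlDl sub0r -normrN ler_norm.
  rewrite Blin // in H1; rewrite Blin // in H2.
  by rewrite ler_norml; move: H1 H2; rewrite mulN1r mul1r; lra.
have cBx := Bell _ dx; have cBax := Bell _ dax.
pose y k := T ax k - truncA A delta (B ax) k.
have Hy k : [/\ `|T x k - truncA A delta (B x) k| <= y k,
    y k <= T ax k & y k <= delta * norm1 (B ax)].
  by rewrite /y !hTAB //; exact: (opA_sub_truncA hw hA hApos delta0 cBax cBx Bax).
have y0 k : 0 <= y k by have [H _ _] := Hy k; apply: le_trans H.
have [df nf] : dw w (fun k => T x k - truncA A delta (B x) k) /\
    normd w (fun k => T x k - truncA A delta (B x) k) <= normd w (T ax).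
  apply: (dw_le hw (Tdw _ dax)) => k; have [H1 H2 _] := Hy k.
  by apply: le_trans H1 (le_trans H2 (ler_norm _)).
have nT : normd w (T ax) <= KT * normd w x.
  by apply: le_trans (HKT _ dax) _; rewrite ler_wpM2l.
(* If [x] had norm 0, the bound by [normd w (T ax)] would make the left-out vector have norm at most
   0, contradicting the strict inequality [big]. *)
have nx : 0 < normd w x.
  have := normd_ge0 hw dx; rewrite le_eqVlt => /predU1P[x0|//].
  by have := lt_le_trans big (le_trans nf nT); rewrite -x0 !mulr0 ltxx.
have [l ul Hl] := normd_lt_lsum hw df big.
set s := normd w x in big nax nT nx Hl *.
have s0 : 0 <= s^-1 by rewrite invr_ge0 ltW.
have [d1 n1] := dwZ hw s^-1 dax; have [d00 _] := dw0 hw.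
(* Dividing by [s] normalizes [|x|], turns the sum over [l] into one of at least [eps], and bounds
   the coordinates of the dominated vector by [d]. *)
exists (fun k => s^-1 * ax k); split => //.
  by apply: le_trans n1 _; rewrite ger0_norm // mulrC ler_pdivrMr // mul1r.
exists (fun k => s^-1 * y k), l; split => //.
  rewrite lsumZ ger0_norm // mulrC ler_pdivlMr //; apply: le_trans (ltW Hl) _.
  by apply: (ler_lsum hw) => k _; rewrite [leRHS]ger0_norm //; case: (Hy k).
move=> k; have [_ yT yd] := Hy k; rewrite (opZ hT _ d00 dax); split.
  by rewrite mulr_ge0 //= ler_wpM2l.
rewrite mulrC ler_pdivrMr //; apply: le_trans yd _.
rewrite /delta mulrAC ler_pdivrMr // -[leRHS]mulrA ler_wpM2l ?(ltW d0) //.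
have := HKB _ dax; have := ler_wpM2l KB0 nax; rewrite mulrDr mulr1 (mulrC s); lra.
Qed.
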